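(* Let $n$ be a positive integer and let $A$ be a subset of $\mathbb{Z}_n$ such that every element of $A$ is coprime with $n$. If $|A|>1+2\sqrt{n-4}$, then $A$ is complete.
   Context: $\mathbb{Z}_n$ denotes the additive group of integers modulo $n$. For a subset $X$ of an abelian group $G$, let $\langle X\rangle$ denote the subgroup generated by $X$, and let $S_X=\bigcup_{k\ge 1}\{\sum_{x\in Y}x : Y\subseteq X,\ |Y|=k\}$ be the set of all sums of nonempty subsets of $X$ (sums of distinct elements). The set $X$ is called complete if $S_X=\langle X\rangle$, i.e. every element of $\langle X\rangle$ is a nonempty sum of distinct elements of $X$. An element $x\in\mathbb{Z}_n$ is coprime with $n$ if any integer representative of $x$ is coprime with $n$.
   Formalization: The case n = 4 is excluded, since the statement fails there: A = {1,3} in Z_4 has 2 > 1 elements coprime with 4, but 2 is not a sum of distinct elements of A; for n < 4, where the square root is not real, the hypothesis is read as |A| > 1. *)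

(* Defs.v *)
From HB Require Import structures.
From mathcomp Require Import all_boot fingroup all_algebra.

Set Implicit Arguments.
Unset Strict Implicit.
Unset Printing Implicit Defensive.

Import GRing.Theory.

Definition subset_sums (G : finZmodType) (X : {set G}) : {set G} :=
  [set (\sum_(x in Y) x)%R | Y : {set G} in powerset X & 0 < #|Y|].

(* The group structure of a finZmodType is the additive one, so <<X>> is the
   additive subgroup generated by X. *)
Definition complete (G : finZmodType) (X : {set G}) : Prop :=
  subset_sums X = <<X>>%g.

(* Why n = 4 has to be excluded: {1, 3} in Z_4 has 2 > 1 + 2 sqrt (4 - 4)
   elements, both coprime with 4, but 2 is not a sum of distinct elements. *)
Lemma not_complete_Z4 : ~ complete [set (1 : 'I_4)%R; inord 3].
Proof.
move/setP/(_ (inord 2)) => E; move: E.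
have -> : inord 2 \in <<[set (1 : 'I_4)%R; inord 3]>>%g.
  have -> : inord 2 = ((1 : 'I_4) + 1)%R by apply: val_inj; rewrite /= inordK.
  by rewrite -FinRing.zmodMgE groupM // mem_gen // !inE eqxx.
move/imsetP => [Y]; rewrite inE => /andP[/= /[!inE] sY _] E.
have : val (\sum_(x in Y) x)%R = 2 by rewrite -E /= inordK.
have memY i : (i : 'I_4) != 1 :> nat -> i != 3 :> nat -> (i \in Y) = false.
  move=> i1 i3; apply/negP => /(subsetP sY); rewrite !inE -!val_eqE /= inordK //.
  by rewrite (negPf i1) (negPf i3).
rewrite big_mkcond !big_ord_recl big_ord0 /= (memY ord0) //.
rewrite (memY (lift ord0 (lift ord0 ord0))) //.
by do 2 case: (_ \in Y).
Qed.

(* Main.v *)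
Require Import Defs.
From mathcomp Require Import all_boot fingroup all_algebra.
From mathcomp Require Import order zify.

(** For a subset B of a cyclic group G of order n, let shift_loss B x be the
    number of b in B with b + x outside B; it is subadditive and even in x, and
    the numbers #|B| - shift_loss B x sum to #|B|^2.  If X consists of s
    generators, no two of them opposite, and shift_loss B <= e on X, then by
    Chowla's theorem shift_loss B <= j e holds on at least min(n, 1 + 2 s j)
    elements; comparing with #|B|^2 bounds e from below by about s.  For B the
    set of all subset sums of X, shift_loss B x is at most the number of sums
    lost when x is removed from X, whence by induction B has at least
    3 + s (s - 1) / 2 or at least (n + 2) / 2 elements.  Finally A is split into
    two halves, neither containing two opposite elements; their sets of subset
    sums have together at least n + 2 elements, so every element of G is a
    nonempty subset sum. *)

Set Implicit Arguments.
Unset Strict Implicit.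
Unset Printing Implicit Defensive.

Import Order.TTheory GRing.Theory Num.Theory.

(** * Numerical inequalities *)

Lemma layer_arith s J e u d q S :
    q + s * J = u.*2 + s -> d + e * J = u.+1 ->
    S + e * s * J = e * J + e * s * J * J ->
    S + d * u.*2.+1 <= u.+1 * u.+1 ->
  u.+1 * u <= e * (J * q).
Proof.
have -> : e * s * J * J = e * J * (s * J) by lia.
have -> : e * s * J = e * J * s by lia.
(* With p = e J and w = s J, eliminating S and d leaves (u + 1)(2 u + 1) - (u + 1)^2 = (u + 1) u
   against p (2 u + s - w) = p q. *)
rewrite (mulnA e); move: (e * J) (s * J) => p w eq_q eq_d eq_S.
have eq_pq : p * (q + w) = p * (u.*2 + s) by rewrite eq_q.
have eq_du : (d + p) * u.*2.+1 = u.+1 * u.*2.+1 by rewrite eq_d.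
by lia.
Qed.

(** With w = 2 (b - 1), the right side minus the left side is (s - e) w^2 - 2 s (e - 1) w - e s^2;
    as s - e >= 2, the first term wins once w is roughly s^2. *)
Lemma loss_bound_low s e b :
    2 < s -> e.+2 <= s -> e.*2 + 6 + s.-1 * s.-2 <= b.*2 ->
  e * (b.-1.*2 + s) ^ 2 < 4 * s * b * b.-1.
Proof.
case: s => [|[|s]] //= s_gt0 les leb.
case: b leb => [|b] /= leb; first lia.
have [w ew] : {w | w = b.*2} by exists b.*2.
have -> : 4 * s.+2 * b.+1 * b = s.+2 * w * (w + 2) by lia.
have [r er] : {r | s = e + r} by exists (s - e); lia.
have lew : s * s + s + 4 + e.*2 <= w by lia.
rewrite -ew.
rewrite er in lew *; rewrite er in s_gt0; clear -lew s_gt0.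
have h1 : w * ((e + r) * (e + r) + (e + r) + 4 + e.*2) <= w * w.
  by rewrite leq_mul2l lew orbT.
have h2 : r * (w * ((e + r) * (e + r) + (e + r) + 4 + e.*2)) <= r * (w * w).
  by rewrite leq_mul2l h1 orbT.
nia.
Qed.

(** Used for complements, where the bound on b is weaker; the larger gap s - e >= 3 makes up for
    it. *)
Lemma loss_bound_high s e b :
    2 < s -> e.+3 <= s -> 3 + s.-1 * s.-2 <= b.*2 ->
  e * (b.-1.*2 + s) ^ 2 < 4 * s * b * b.-1.
Proof.
case: s => [|[|[|s]]] //= _ les leb.
case: b leb => [|b] /= leb; first lia.
have [w ew] : {w | w = b.*2} by exists b.*2.
have -> : 4 * s.+3 * b.+1 * b = s.+3 * w * (w + 2) by lia.
have lew : s * s + 3 * s + 3 <= w by lia.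
rewrite -ew; apply: leq_ltn_trans (_ : s * (w + s.+3) ^ 2 < _).
  by rewrite leq_mul2r; apply/orP; right; lia.
clear -lew.
have h1 : w * (s * s + 3 * s + 3) <= w * w.
  by rewrite leq_mul2l lew orbT.
nia.
Qed.

Section CyclicSubsetSums.
Variable G : finZmodType.
Implicit Types (A B X Y : {set G}) (x y : G).

(** * Generators and Chowla's theorem *)

Definition zgenerator x := forall y, exists k, y = (x *+ k)%R.

Lemma zgeneratorN x : zgenerator x -> zgenerator (- x)%R.
Proof. by move=> gx y; have [k ky] := gx (- y)%R; exists k; rewrite mulNrn -ky opprK. Qed.

Lemma zgenerator_neqN x : 2 < #|G| -> zgenerator x -> x != (- x)%R.
Proof.
move=> G2 gx; apply: contraTneq G2 => xN; rewrite -leqNgt.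
have x2 : (x + x = 0)%R by rewrite {2}xN subrr.
apply: leq_trans (_ : #|[set 0%R; x]| <= 2); last by rewrite cards2; case: eqP.
rewrite -cardsT; apply/subset_leq_card/subsetP=> y _.
have [k ->] := gx y; rewrite !inE.
elim: k => [|k]; first by rewrite mulr0n eqxx.
by rewrite mulrS => /orP[] /eqP ->; rewrite ?addr0 ?x2 eqxx ?orbT.
Qed.

Lemma zgenerator_stable x A :
  zgenerator x -> A != set0 -> (forall a, a \in A -> (a + x)%R \in A) -> A = setT.
Proof.
move=> gx /set0Pn[a aA] stA; apply/setP=> y; rewrite inE.
have [k /(canRL (subrK _))->] := gx (y - a)%R.
by elim: k => [|k IH]; rewrite ?mulr0n ?add0r // mulrSr addrAC stA.
Qed.

Definition sumset A B := [set (a + b)%R | a in A, b in B].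

(** Induction on [#|B|]. If A + B lies in A, then B = {0} or A is the whole group; otherwise a
    transform keeps [#|A| + #|B|], shrinks B and does not enlarge the sumset. *)
Lemma chowla A B :
    A != set0 -> 0%R \in B -> (forall b, b \in B -> b != 0%R -> zgenerator b) ->
  minn #|G| (#|A| + #|B|).-1 <= #|sumset A B|.
Proof.
have [m] := ubnP #|B|; elim: m A B => // m IH A B /ltnSE leBm A0 B0 gB.
have sA : A \subset sumset A B.
  by apply/subsetP=> a aA; apply/imset2P; exists a 0%R; rewrite ?addr0.
have [/forall_inP stA | ] :=
  boolP [forall a in A, [forall b in B, (a + b)%R \in A]].
  have [/eqP B1 | ] := boolP (B == [set 0%R]).
    by rewrite B1 cards1 addn1 /= geq_min -B1 (subset_leq_card sA) orbT.
  rewrite eqEsubset sub1set B0 andbT => /subsetPn[b bB]; rewrite inE => b0.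
  have AT : A = setT.
    by apply: (zgenerator_stable (gB b bB b0)) => // a /stA /forall_inP; apply.
  by rewrite geq_min -cardsT -[in #|setT|]AT (subset_leq_card sA).
rewrite negb_forall_in => /exists_inP[a aA]; rewrite negb_forall_in => /exists_inP[b bB abA].
(* Dyson's e-transform of the pair (A, B) *)
pose B' := [set x in B | (a + x)%R \in A].
pose aB := [set (a + x)%R | x in B].
pose A' := A :|: aB.
have sB' : B' \proper B.
  apply/properP; split; first by apply/subsetP=> x; rewrite inE => /andP[].
  by exists b; rewrite // inE bB.
have aBI : #|A :&: aB| = #|B'|.
  rewrite -(card_imset (mem B') (addrI a)); apply: eq_card => y.
  apply/setIP/imsetP => [[yA /imsetP[x xB ey]]|[x]].
    by exists x; rewrite // inE xB -ey.
  by rewrite inE => /andP[xB axA] ->; split; rewrite // imset_f.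
have eqAB : #|A'| + #|B'| = #|A| + #|B|.
  by rewrite -aBI cardsUI (card_imset _ (addrI a)).
have sS : sumset A' B' \subset sumset A B.
  apply/subsetP=> _ /imset2P[x y + + ->]; rewrite !inE => xA' /andP[yB ayA].
  case/orP: xA' => [xA|/imsetP[z zB ->]]; first by apply/imset2P; exists x y.
  by apply/imset2P; exists (a + y)%R z; rewrite // addrAC.
apply: leq_trans (subset_leq_card sS); rewrite -eqAB; apply: IH.
- exact: leq_trans (proper_card sB') leBm.
- by apply/set0Pn; exists a; rewrite inE aA.
- by rewrite inE B0 addr0.
- by move=> x; rewrite inE => /andP[xB _]; apply: gB.
Qed.

(** * Elements lost under a shift *)

Definition shift_loss B x := #|[set b in B | (b + x)%R \notin B]|.

Lemma shift_lossK B x :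
  #|[set b in B | (b + x)%R \in B]| + shift_loss B x = #|B|.
Proof.
rewrite -(cardsID [set b | (b + x)%R \in B] B); congr (_ + _).
  by apply: eq_card => b; rewrite !inE.
by apply: eq_card => b; rewrite !inE andbC.
Qed.

Lemma shift_loss0 B : shift_loss B 0%R = 0.
Proof.
by apply/eqP; rewrite cards_eq0; apply/eqP/setP => b; rewrite !inE addr0 andbN.
Qed.

Lemma shift_lossN B x : shift_loss B (- x)%R = shift_loss B x.
Proof.
apply: (@addnI #|[set b in B | (b + x)%R \in B]|); rewrite shift_lossK.
rewrite -(shift_lossK B (- x)%R); congr (_ + _).
rewrite -(card_imset _ (addIr x)); apply: eq_card => b.
apply/imsetP/idP => [[c]|]; rewrite inE => /andP[cB cxB].
  by move->; rewrite inE cxB addrK.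
by exists (b - x)%R; rewrite ?subrK // inE ?subrK cxB.
Qed.

(** Adding x matches the elements that leave the complement with those of B that a shift by -x moves
    out of B. *)
Lemma shift_lossC B x : shift_loss (~: B) x = shift_loss B x.
Proof.
rewrite -(shift_lossN B) /shift_loss -(card_imset _ (addIr x)); apply: eq_card => b.
apply/imsetP/idP => [[c]|]; rewrite !inE ?negbK => /andP[cB cxB].
  by move->; rewrite cxB addrK.
by exists (b - x)%R; rewrite ?subrK // !inE subrK cxB cB.
Qed.

Lemma shift_lossD B x y :
  shift_loss B (x + y)%R <= shift_loss B x + shift_loss B y.
Proof.
pose S := [set b in B | ((b + x)%R \in B) && ((b + x + y)%R \notin B)].
apply: leq_trans (_ : shift_loss B x + #|S| <= _).
  apply: leq_trans (leq_card_setU _ _); apply/subset_leq_card/subsetP=> b.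
  by rewrite !inE addrA => /andP[-> ->] /=; rewrite andbT orNb.
rewrite leq_add2l -(card_imset _ (addIr x)).
apply/subset_leq_card/subsetP=> _ /imsetP[b + ->].
by rewrite !inE => /and3P[_ -> ->].
Qed.

(** Double counting: the pairs (b, b + x) with both entries in B run over all of B x B. *)
Lemma sum_shift_loss B : \sum_x (#|B| - shift_loss B x) = #|B| * #|B|.
Proof.
under eq_bigr => x _ do rewrite -{1}(shift_lossK B x) addnK -sum1_card.
under eq_bigr => x _ do under eq_bigl => b do rewrite inE.
rewrite (exchange_big_dep (mem B)) /=; last by move=> x b _ /andP[].
rewrite -sum_nat_const; apply: eq_bigr => b bB.
under eq_bigl => x do rewrite bB /=.
rewrite sum1_card -(card_imset _ (addrI b)); apply: eq_card => y.
apply/imsetP/idP => [[x] + ->//|yB]; exists (y - b)%R; last by rewrite addrC subrK.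
by rewrite unfold_in addrC subrK.
Qed.

Definition antisymmetric_set X := forall x, x \in X -> (- x)%R \notin X.

(* The sets [set y | shift_loss B y <= e * j] grow at least linearly in j by
   Chowla's theorem, while the sum over y of #|B| - shift_loss B y is fixed. *)
Lemma shift_loss_bound X B e :
    antisymmetric_set X -> (forall x, x \in X -> zgenerator x) ->
    0 < #|X| -> 0 < #|B| -> #|B|.*2 <= #|G|.+1 ->
    (forall x, x \in X -> shift_loss B x <= e) ->
  4 * #|X| * #|B| * #|B|.-1 <= e * (#|B|.-1.*2 + #|X|) ^ 2.
Proof.
move=> asX gX X_gt0 B_gt0 leBG leXe.
pose NX : {set G} := [set (- x)%R | x in X].
pose C : {set G} := 0%R |: (X :|: NX).
have NXP x : (x \in NX) = ((- x)%R \in X).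
  by apply/imsetP/idP=> [[y yX ->]|]; [rewrite opprK | exists (- x)%R; rewrite ?opprK].
have cardC : #|C| = #|X|.*2.+1.
  rewrite cardsU1 !inE NXP oppr0.
  have -> : (0%R \in X) = false.
    by apply/negP=> X0; have := asX _ X0; rewrite oppr0 X0.
  rewrite cardsU card_imset; last exact: oppr_inj.
  have -> : X :&: NX = set0.
    by apply/setP=> x; rewrite !inE NXP; apply/negP=> /andP[/asX/negP].
  by rewrite cards0 subn0 addnn.
pose F j := [set y | shift_loss B y <= e * j].
have F0 j : 0%R \in F j by rewrite inE shift_loss0.
have cardF j : minn #|G| (#|X|.*2 * j).+1 <= #|F j|.
  elim: j => [|j IH].
    by rewrite muln0 geq_min card_gt0; apply/orP; right; apply/set0Pn; exists 0%R.
  have sF : sumset (F j) C \subset F j.+1.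
    apply/subsetP=> _ /imset2P[x y xF yC ->]; rewrite inE.
    apply: leq_trans (shift_lossD _ _ _) _; rewrite mulnS addnC.
    move: xF; rewrite inE => xF; apply: leq_add => //.
    move: yC; rewrite !inE NXP => /or3P[/eqP->|/leXe//|/leXe]; first by rewrite shift_loss0.
    by rewrite shift_lossN.
  apply: leq_trans (subset_leq_card sF); apply: leq_trans (chowla _ _ _).
  - by rewrite cardC; move: IH; rewrite mulnS; lia.
  - by apply/set0Pn; exists 0%R.
  - by rewrite !inE eqxx.
  move=> y; rewrite !inE NXP => /or3P[->//|/gX//|/gX/zgeneratorN].
  by rewrite opprK.
move: leBG B_gt0 X_gt0 cardF (sum_shift_loss B).
set b := #|B|; set s := #|X|; set N := #|G| => leBG b_gt0 s_gt0 cardF sumB.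
(* J is (b - 1) / s rounded up, the first level at which 1 + 2 s J reaches 2 b - 1. *)
pose J := (b.-1 + s.-1) %/ s.
have leJ : b.-1 <= s * J by rewrite mulnC; have := ltn_ceil (b.-1 + s.-1) s_gt0; lia.
have ltJ j : j < J -> s * j < b.-1.
  by have := leq_divM (b.-1 + s.-1) s; nia.
have [leJb | ltbJ] := leqP (e * J) b; last first.
  have : s * J <= b.-1 + s.-1 by rewrite mulnC leq_divM.
  by nia.
(* Layer-cake estimate: J slices of height e, plus a slice of height b - e J over the top level
   set. *)
have level_sum : \sum_(j < J) e * #|F j| + (b - e * J) * #|F J| <= b * b.
  have levels y : \sum_(j < J) e * (y \in F j) <= e * J - shift_loss B y.
    elim: (J) => [|k IHk]; first by rewrite big_ord0.
    rewrite big_ord_recr /= mulnS inE; move: IHk; set S := bigop _ _ _.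
    by case: (leqP (shift_loss B y)); rewrite ?muln1 ?muln0; lia.
  apply: leq_trans (_ : \sum_y (\sum_(j < J) e * (y \in F j) + (b - e * J) * (y \in F J)) <= _).
    have sumF c k : \sum_y c * (y \in F k) = c * #|F k|.
      by rewrite -big_distrr -sum1_card [in RHS]big_mkcond.
    rewrite big_split /= exchange_big sumF leq_add2r /=.
    by under [leqRHS]eq_bigr => j _ do rewrite sumF.
  rewrite -sumB; apply: leq_sum => y _; have := levels y; rewrite inE.
  set S := bigop _ _ _; move: leJb; case: (leqP (shift_loss B y)); rewrite ?muln1 ?muln0 -/b; lia.
(* Below level J, 1 + 2 s j is at most [#|G|], so the minimum in [cardF] is its linear term. *)
have lowJ : \sum_(j < J) e * (s.*2 * j).+1 <= \sum_(j < J) e * #|F j|.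
  apply: leq_sum => j _; rewrite leq_mul2l; apply/orP; right.
  by apply: leq_trans (cardF j); have := ltJ j (ltn_ord j); lia.
have gauss k : \sum_(j < k) e * (s.*2 * j).+1 + e * s * k = e * k + e * s * k * k.
  elim: k => [|k IHk]; first by rewrite big_ord0; lia.
  by rewrite big_ord_recr /=; move: IHk; set S := bigop _ _ _; nia.
have {}cardF : b.*2.-1 <= #|F J| by apply: leq_trans (cardF J); lia.
have leFJ : (b - e * J) * b.*2.-1 <= (b - e * J) * #|F J|.
  by rewrite leq_mul2l cardF orbT.
have leJs : s * J <= b.-1 + s.-1 by rewrite mulnC leq_divM.
(* AM-GM on s J and 2 (b - 1) + s - s J removes the dependence on J. *)
have agm := nat_AGM2 (s * J) (b.-1.*2 + s - s * J).
rewrite subnKC in agm; last by lia.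
have main : b * b.-1 <= e * (J * (b.-1.*2 + s - s * J)).
  have eq_b : b = b.-1.+1 by lia.
  rewrite [X in X * _]eq_b; apply: layer_arith (gauss J) _; first by rewrite subnK //; lia.
  - by rewrite -eq_b; exact: subnK.
  rewrite -eq_b; apply: leq_trans level_sum; apply: leq_add lowJ _.
  by apply: leq_trans leFJ; rewrite leq_mul2l; apply/orP; right; lia.
apply: leq_trans (_ : e * (4 * (s * J * (b.-1.*2 + s - s * J))) <= _); last first.
  by rewrite leq_mul2l agm orbT.
move: main; move: (_ - s * J) => q main.
have -> : e * (4 * (s * J * q)) = 4 * s * (e * (J * q)) by lia.
by rewrite -mulnA leq_mul2l main orbT.
Qed.

(** * Sets of subset sums, the empty sum included *)

Definition sums X := [set (\sum_(x in Y) x)%R | Y : {set G} in powerset X].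

Lemma mem_sums X Y : Y \subset X -> (\sum_(x in Y) x)%R \in sums X.
Proof. by move=> sYX; apply: imset_f; rewrite inE. Qed.

Lemma sumsS X Y : Y \subset X -> sums Y \subset sums X.
Proof.
move=> sYX; apply/subsetP=> _ /imsetP[Z + ->]; rewrite inE => sZY.
exact/mem_sums/(subset_trans sZY).
Qed.

Lemma sums_addr X x y : x \in X -> y \in sums (X :\ x) -> (y + x)%R \in sums X.
Proof.
move=> xX /imsetP[Z + ->]; rewrite inE subsetD1 => /andP[sZX xZ].
by rewrite addrC -(big_setU1 _ xZ) mem_sums // subUset sub1set xX.
Qed.

(** A sum avoiding x stays a sum after adding x, so only elements outside [sums (X :\ x)] can be
    lost. *)
Lemma shift_loss_sums X x :
  x \in X -> shift_loss (sums X) x + #|sums (X :\ x)| <= #|sums X|.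
Proof.
move=> xX; rewrite -(shift_lossK (sums X) x) addnC leq_add2r.
apply/subset_leq_card/subsetP=> y yS; rewrite inE sums_addr // andbT.
exact: subsetP (sumsS (subD1set _ _)) _ yS.
Qed.

Lemma card_sums2 x y :
  antisymmetric_set [set x; y] -> x != y -> 4 <= #|sums [set x; y]|.
Proof.
move=> asX neq_xy.
have nz z : z \in [set x; y] -> z != 0%R.
  by move=> zX; have := asX _ zX; apply: contraNneq => z0; rewrite z0 oppr0 -z0.
have x0 : x != 0%R by rewrite nz // set21.
have y0 : y != 0%R by rewrite nz // set22.
have xy0 : (x + y != 0)%R.
  rewrite addr_eq0; apply/negP=> /eqP xN; have := asX y (set22 _ _).
  by rewrite -xN set21.
have -> : 4 = #|[set 0; x; y; x + y]%R|.
  rewrite -!setUA !cardsU1 !inE cards1 ![(0 == _)%R]eq_sym.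
  rewrite -[(x == _ + _)%R]subr_eq0 -[(y == _ + _)%R]subr_eq0 opprD addrA subrr sub0r oppr_eq0.
  rewrite [(- x - y)%R]addrC addNKr oppr_eq0.
  by rewrite (negPf x0) (negPf y0) (negPf xy0) (negPf neq_xy).
apply/subset_leq_card/subsetP=> z; rewrite !inE -!orbA => /or4P[] /eqP->.
- by have := @mem_sums [set x; y] set0 (sub0set _); rewrite big_set0.
- by have := @mem_sums [set x; y] [set x]; rewrite big_set1 sub1set set21; apply.
- by have := @mem_sums [set x; y] [set y]; rewrite big_set1 sub1set set22; apply.
- have := @mem_sums [set x; y] _ (subxx _).
  by rewrite big_setU1 ?big_set1 // inE.
Qed.

Lemma antisymmetric_setS X Y : Y \subset X -> antisymmetric_set X -> antisymmetric_set Y.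
Proof.
move=> /subsetP sYX asX x /sYX/asX; exact/contra/sYX.
Qed.

(** Induction on [#|X|], starting from the four sums 0, x, y, x + y. If both bounds failed, shifts
    by elements of X would lose too little for [shift_loss_bound]. *)
Lemma card_sums_ge X :
    antisymmetric_set X -> (forall x, x \in X -> zgenerator x) -> 1 < #|X| ->
  minn (6 + #|X| * #|X|.-1) #|G|.+2 <= #|sums X|.*2.
Proof.
have [m] := ubnP #|X|; elim: m X => // m IH X /ltnSE leXm asX gX X_gt1.
have [/cards2P[x [y [neq_xy eqX]]] | X_neq2] := boolP (#|X| == 2).
  rewrite eqX in asX *; have := card_sums2 asX neq_xy.
  by rewrite cards2 neq_xy; lia.
rewrite leqNgt; apply/negP; rewrite leq_min => /andP[lt_quad lt_G].
(* [sums (X :\ x)] is too small for the second bound, so induction gives the quadratic one. *)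
have IHx x : x \in X -> 6 + #|X|.-1 * #|X|.-2 <= #|sums (X :\ x)|.*2.
  move=> xX; have sX := subD1set X x.
  have cX : #|X :\ x| = #|X|.-1 by rewrite (cardsD1 x X) xX.
  have := IH (X :\ x); rewrite cX => /(_ _ (antisymmetric_setS sX asX)).
  have := subset_leq_card (sumsS sX); move=> leS IH'.
  have : minn (6 + #|X|.-1 * #|X|.-2) #|G|.+2 <= #|sums (X :\ x)|.*2.
    by apply: IH'; [lia | move=> z /(subsetP sX)/gX | lia].
  by lia.
(* Half the excess over the quadratic bound for [#|X|.-1] elements; it is at most [#|X| - 2], since
   consecutive quadratic bounds differ by [2 * #|X|.-1]. *)
pose e := (#|sums X|.*2 - (6 + #|X|.-1 * #|X|.-2))./2.
have [x0 x0X] : exists x, x \in X by apply/card_gt0P; lia.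
have lossX x : x \in X -> shift_loss (sums X) x <= e.
  move=> xX; have := IHx x xX; have := shift_loss_sums xX.
  by rewrite /e geq_half_double; set Q := 6 + _; lia.
have IH0 : 6 + #|X|.-1 * #|X|.-2 <= #|sums X|.*2.
  apply: leq_trans (IHx _ x0X) _; rewrite leq_double.
  exact/subset_leq_card/sumsS/subD1set.
have S_gt0 : 0 < #|sums X| by rewrite -double_gt0; apply: leq_trans IH0.
have lt_sumsG : #|sums X|.*2 <= #|G|.+1 by lia.
have := shift_loss_bound asX gX (ltnW X_gt1) S_gt0 lt_sumsG lossX.
rewrite leqNgt loss_bound_low //.
- by lia.
- by rewrite /e; nia.
have: e.*2 <= #|sums X|.*2 - (6 + #|X|.-1 * #|X|.-2) by rewrite -geq_half_double.
by rewrite leq_subRL // addnC addnA.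
Qed.

(** For [#|A|] odd, the larger half Y makes up for what the quadratic bound on the smaller half may
    lack. Otherwise the complement of [sums Y], at most half of G and with the same small losses,
    would contradict [shift_loss_bound]. *)
Lemma card_sums_ge_compl Y s :
    antisymmetric_set Y -> (forall x, x \in Y -> zgenerator x) ->
    #|Y| = s.+1 -> 1 < s -> #|G| <= s * s + 3 ->
  #|G|.*2 + 4 <= #|sums Y|.*2 + (6 + s * s.-1).
Proof.
move=> asY gY cY s_gt1 leG; rewrite leqNgt; apply/negP=> lt_sum.
have := card_sums_ge asY gY; rewrite cY => /(_ (ltnW s_gt1)) geY.
have {}geY : #|G|.+2 <= #|sums Y|.*2 by nia.
have cYx x : x \in Y -> #|Y :\ x| = s by move=> xY; apply: succn_inj; rewrite -cY (cardsD1 x Y) xY.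
have lossY x : x \in Y -> shift_loss (~: sums Y) x <= s - 2.
  move=> xY; have sY := subD1set Y x; rewrite shift_lossC.
  have := @card_sums_ge (Y :\ x) (antisymmetric_setS sY asY) (fun z zY => gY z (subsetP sY z zY)).
  rewrite cYx // => /(_ s_gt1) IH; have := shift_loss_sums xY; nia.
have cC : #|sums Y| + #|~: sums Y| = #|G| := cardsC _.
have Y_gt0 : 0 < #|Y| by rewrite cY.
have C_gt0 : 0 < #|~: sums Y| by nia.
have leC : #|~: sums Y|.*2 <= #|G|.+1 by lia.
have := shift_loss_bound asY gY Y_gt0 C_gt0 leC lossY.
rewrite leqNgt loss_bound_high ?cY //; first by lia.
by move: lt_sum; rewrite /= -cC; set Q := s * _; move: Q #|sums Y| #|~: sums Y|; clear; lia.
Qed.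

(** * Splitting a set into halves without opposite elements *)

Lemma antisymmetric_setU1 a X :
    a != (- a)%R -> (- a)%R \notin X -> antisymmetric_set X ->
  antisymmetric_set (a |: X).
Proof.
move=> aN NaX asX x; rewrite !inE => /orP[/eqP->|xX].
  by rewrite eq_sym negb_or aN.
rewrite negb_or asX // andbT; apply: contraNneq NaX => <-.
by rewrite opprK.
Qed.

(** Each opposite pair is shared out between the halves; once none is left, any half works. *)
Lemma antisymmetric_split A : (forall x, x \in A -> x != (- x)%R) ->
  exists X, [/\ X \subset A, #|X| = #|A|./2,
                antisymmetric_set X & antisymmetric_set (A :\: X)].
Proof.
have [m] := ubnP #|A|; elim: m A => // m IH A /ltnSE leAm neqN.
have [/exists_inP[a aA NaA] | noN] := boolP [exists a in A, (- a)%R \in A]; last first.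
  have asA : antisymmetric_set A.
    by move=> x xA; apply: contra noN => NxA; apply/exists_inP; exists x.
  pose X := [set x in take #|A|./2 (enum A)].
  have sXA : X \subset A.
    by apply/subsetP=> x; rewrite inE => /mem_take; rewrite mem_enum.
  exists X; split=> //; try exact: antisymmetric_setS asA.
    rewrite cardsE (card_uniqP _) ?take_uniq ?enum_uniq //.
    by rewrite size_takel // -cardE leq_half_double -addnn leqW ?leq_addr.
  exact: antisymmetric_setS (subsetDl _ _) asA.
have aN := neqN a aA.
pose A' := A :\ a :\ (- a)%R.
have sA' : A' \subset A by rewrite (subset_trans (subD1set _ _)) ?subD1set.
have cA : #|A| = #|A'|.+2.
  by rewrite (cardsD1 a) aA (cardsD1 (- a)%R (A :\ a)) !inE eq_sym aN NaA.
have [||X [sXA' cX asX asY]] := IH A'; first by lia.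
  by move=> x /(subsetP sA'); apply: neqN.
have aA' : a \notin A' by rewrite !inE eqxx andbF.
have NaA' : (- a)%R \notin A' by rewrite !inE eqxx.
exists (a |: X); split.
- by rewrite subUset sub1set aA (subset_trans sXA').
- by rewrite cardsU1 (contra (subsetP sXA' a)) // cX cA.
- by apply: antisymmetric_setU1; rewrite // (contra (subsetP sXA' _)).
have -> : A :\: (a |: X) = (- a)%R |: (A' :\: X).
  apply/setP=> x; rewrite !inE; have [->|xN] := eqVneq x (- a)%R.
    by rewrite eq_sym (negPf aN) NaA (contra (subsetP sXA' _)).
  by case: (x == a); case: (x \in X).
by apply: antisymmetric_setU1; rewrite ?opprK 1?eq_sym // inE (negPf aA') andbF.
Qed.

(** * Completeness of sets of generators *)

Lemma sum_mem_subset_sums A (Z : {set G}) :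
  Z \subset A -> Z != set0 -> (\sum_(z in Z) z)%R \in subset_sums A.
Proof. by move=> sZA Z0; apply: imset_f; rewrite !inE sZA card_gt0. Qed.

(* Two more sums than elements of G give two representations of each element,
   so that 0 has one with a nonempty index set. *)
Lemma subset_sums_setT A X :
    X \subset A -> #|G|.+2 <= #|sums X| + #|sums (A :\: X)| ->
  subset_sums A = setT.
Proof.
move=> sXA large; apply/setP=> g; rewrite inE.
pose T := [set (g - t)%R | t in sums (A :\: X)].
have cT : #|T| = #|sums (A :\: X)|.
  by apply: card_imset => t u /addrI/oppr_inj.
have : 0 < #|(sums X :&: T) :\ 0%R|.
  have : #|sums X :|: T| <= #|G| := max_card _.
  have := cardsUI (sums X) T; have := cardsD1 0%R (sums X :&: T).
  by rewrite cT; case: (_ \in _); lia.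
rewrite card_gt0 => /set0Pn[t]; rewrite !inE => /and3P[t0].
case/imsetP=> X1 + et; rewrite inE => sX1 /imsetP[u /imsetP[Y1 + eu] etu].
rewrite inE subsetD => /andP[sY1A dY1].
have -> : g = (\sum_(z in X1 :|: Y1) z)%R.
  rewrite (eq_bigl (fun z => z \in [predU X1 & Y1])); last by move=> z; rewrite !inE.
  rewrite bigU /=; first by rewrite -et -eu etu subrK.
  by rewrite disjoint_sym; apply: disjointWr dY1.
apply: sum_mem_subset_sums; first by rewrite subUset (subset_trans sX1).
apply: contraNneq t0 => /eqP; rewrite setU_eq0 => /andP[/eqP X10 _].
by rewrite et X10 big_set0.
Qed.

Lemma complete_setT A x :
  x \in A -> zgenerator x -> subset_sums A = setT -> complete A.
Proof.
move=> xA gx ST; rewrite /complete ST; apply/esym/setP=> y; rewrite inE.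
by have [k ->] := gx y; rewrite -FinRing.zmodXgE groupX // mem_gen.
Qed.

Theorem complete_of_zgenerators A :
    (forall x, x \in A -> zgenerator x) -> #|G| <> 4 -> 1 < #|A| ->
    4 * #|G| < #|A|.-1 ^ 2 + 16 ->
  complete A.
Proof.
move=> gA neq4 A_gt1 large.
have /card_gt0P[a aA] : 0 < #|A| by lia.
apply: (complete_setT aA (gA a aA)).
have G_gt1 : 1 < #|G| by apply: leq_trans (max_card A).
have A0 : 0%R \notin A.
  apply/negP=> /gA g0; have /card_gt1P[x [y [_ _]]] := G_gt1.
  by have [k ->] := g0 x; have [l ->] := g0 y; rewrite !mul0rn eqxx.
have G_gt2 : 2 < #|G|.
  apply: leq_trans (_ : #|0%R |: A| <= _); first by rewrite cardsU1 A0.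
  exact: max_card.
(* In order 3 the halves of A are singletons, too small for [card_sums_ge]; here x, y and x + y
   exhaust G. *)
have [eq3 | neq3] := eqVneq #|G| 3.
  have /card_gt1P[x [y [xA yA neq_xy]]] := A_gt1.
  apply/eqP; rewrite eqEcard subsetT cardsT eq3 /=.
  have nz z : z \in A -> z != 0%R by apply: contraTneq => ->.
  have -> : 3 = #|[set x; y; x + y]%R|.
    rewrite -!setUA !cardsU1 !inE cards1 negb_or neq_xy /=.
    rewrite -[(x == _ + _)%R]subr_eq0 -[(y == _ + _)%R]subr_eq0 opprD addrA subrr sub0r oppr_eq0.
    by rewrite [(- x - y)%R]addrC addNKr oppr_eq0 !nz.
  apply/subset_leq_card/subsetP=> z; rewrite !inE -orbA => /or3P[] /eqP->.
  - have := @sum_mem_subset_sums A [set x]; rewrite big_set1 sub1set xA; apply=> //.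
    by apply/set0Pn; exists x; rewrite inE.
  - have := @sum_mem_subset_sums A [set y]; rewrite big_set1 sub1set yA; apply=> //.
    by apply/set0Pn; exists y; rewrite inE.
  have := @sum_mem_subset_sums A [set x; y]; rewrite big_setU1 ?inE // big_set1.
  rewrite subUset !sub1set xA yA; apply=> //.
  by apply/set0Pn; exists x; rewrite set21.
have [|X [sXA cX asX asY]] := @antisymmetric_split A.
  by move=> x /gA; apply: zgenerator_neqN.
apply: (subset_sums_setT sXA); set Y := A :\: X in asY *.
have gX x : x \in X -> zgenerator x by move/(subsetP sXA)/gA.
have gY x : x \in Y -> zgenerator x by rewrite inE => /andP[_ /gA].
have cY : #|X| + #|Y| = #|A|.
  by rewrite -(cardsID X A) (setIidPr sXA).
(* Now [#|G|] is at least 5, so [large] forces [#|A|] to be at least 4. *)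
have X_gt1 : 1 < #|X| by rewrite cX; nia.
have Y_gt1 : 1 < #|Y| by lia.
have geX := card_sums_ge asX gX X_gt1.
have geY := card_sums_ge asY gY Y_gt1.
(* If [#|A|] = 2 s + 1, [large] only bounds [#|G|] by s^2 + 3, so 6 + s (s - 1) may fall short of
   [#|G|.+2]. *)
have [odA | evA] := boolP (odd #|A|).
  have {}cY : #|Y| = #|X|.+1 by lia.
  have leG : #|G| <= #|X| * #|X| + 3.
    have eA : #|A|.-1 = #|X|.*2 by lia.
    by move: large; rewrite eA; nia.
  have geC := card_sums_ge_compl asY gY cY X_gt1 leG.
  move: geX geY geC leG; rewrite cY /= mulSn; clear.
  move: #|X| #|sums X| #|sums Y| #|G| => s a b n.
  by move: (s * s) (s * s.-1) => p q; lia.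
(* If [#|A|] = 2 s, [large] bounds [#|G|.+2] by 6 + s (s - 1), so the sums of each half fill more
   than half of G. *)
have {}cY : #|Y| = #|X| by lia.
have eA : #|A| = #|X|.*2 by lia.
move: geX geY large X_gt1; rewrite cY eA; clear.
by move: #|X| #|sums X| #|sums Y| #|G| => [|s] //= a b n; nia.
Qed.

End CyclicSubsetSums.

(** * Transfer to the integers modulo n *)

Lemma zgenerator_coprime n (x : 'I_n.+1) : coprime x n.+1 -> zgenerator x.
Proof.
move=> cop y.
have [x0 | x_gt0] := posnP x.
  move: cop; rewrite x0 /coprime gcd0n => /eqP[n0].
  by exists 0; apply: val_inj; case: y => m /= lt_m; move: lt_m; rewrite n0 ltnS leqn0 => /eqP.
(* Bezout: u x = 1 modulo n + 1, so y = (u y) x. *)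
have /(coprimeP _ x_gt0)[[u v] /= uv] := cop.
exists (u * y); apply: val_inj; rewrite Zp_mulrn /= mulnA [x * u]mulnC.
have -> : u * x = v * n.+1 + 1 by lia.
by rewrite mulnDl mul1n mulnAC modnMDl modn_small.
Qed.

(* Z_n is 'I_n.-1.+1 (rather than 'Z_n, which is Z/2 for n = 1). *)
Theorem theorem1 (R : rcfType) (n : nat) (n_gt0 : 0 < n) (n_neq4 : n <> 4)
    (A : {set 'I_n.-1.+1})
    (A_coprime : forall x : 'I_n.-1.+1, x \in A -> coprime x n)
    (A_large : (1 + 2 * Num.sqrt (n%:R - 4) < #|A|%:R :> R)%R) :
  complete A.
Proof.
have cardG : #|'I_n.-1.+1| = n by rewrite card_ord prednK.
have A_gt1 : 1 < #|A|.
  rewrite -(ltr_nat R); apply: le_lt_trans A_large.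
  by rewrite lerDl mulr_ge0 ?sqrtr_ge0.
apply: complete_of_zgenerators => //.
- by move=> x xA; apply: zgenerator_coprime; rewrite [X in coprime _ X]prednK ?A_coprime.
- by rewrite cardG.
(* For n < 4 the square root has its default value 0, and the goal holds because 4 n < 16. *)
rewrite cardG; have [lt_n4 | le_4n] := ltnP n 4; first by lia.
have : (4 * (n%:R - 4) < (#|A|.-1)%:R ^+ 2 :> R)%R.
  rewrite -[X in (4 * X < _)%R]sqr_sqrtr; last by rewrite subr_ge0 ler_nat.
  have four : (4 = 2 ^+ 2 :> R)%R by rewrite -natrX.
  rewrite [X in (X * _ < _)%R]four -exprMn ltrXn2r ?mulr_ge0 ?sqrtr_ge0 //.
  by rewrite -subn1 natrB 1?ltnW // ltrBrDl.
rewrite -natrB // -natrM -natrX ltr_nat => lt_sq.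
by have : 4 * n < #|A|.-1 ^ 2 + 16 by move: lt_sq; move: (_ ^ 2) => q; lia.
Qed.
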